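(* The algebraic matroid $\mathcal M_2$ of the second Heron variety $X_2\subseteq\mathbb C^4$, with ground set $\{12,13,23,123\}$, is the uniform matroid $U(3,4)$ of rank $3$ on $4$ elements. Its unique circuit is $\{12,13,23,123\}$.
   Context: A subset such as $\{1,2,3\}$ is abbreviated $123$. The second Heron variety $X_2\subseteq\mathbb C^4$ (coordinates $x_{12},x_{13},x_{23},x_{123}$) is the Zariski closure of the image of $\varphi_2:\mathbb C^3\to\mathbb C^4$, $(x_{12},x_{13},x_{23})\mapsto(x_{12},x_{13},x_{23},x_{123})$, where $$x_{123}=\tfrac1{16}\left(2x_{12}x_{13}+2x_{12}x_{23}+2x_{13}x_{23}-x_{12}^2-x_{13}^2-x_{23}^2\right).$$ For an irreducible affine variety $X\subseteq\mathbb C^N$, the algebraic matroid $\mathcal M(X)$ has ground set the set of coordinate indices; its bases are the subsets $B$ for which the coordinate projection $\pi_B:X\to\mathbb C^{|B|}_B$, $\mathbf x\mapsto(x_b)_{b\in B}$, is finite-to-one (on generic fibres) and dominant. Circuits are the minimal subsets not contained in any basis. $\mathcal M_2=\mathcal M(X_2)$. *)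

(* Defs.v *)
From HB Require Import structures.
From mathcomp Require Import all_boot all_order all_algebra.
From mathcomp Require Import boolp classical_sets cardinality reals.
From mathcomp Require Import complex mpoly.

Set Implicit Arguments.
Unset Strict Implicit.
Unset Printing Implicit Defensive.

Import GRing.Theory.

Local Open Scope ring_scope.

(* Matroids on a finite ground set, given by their set of bases. *)
Section Matroids.
Variable E : finType.
Implicit Types (Bs : {set {set E}}) (A B D : {set E}).

Definition is_matroid Bs : Prop :=
  (exists B, B \in Bs) /\
  (forall A B, A \in Bs -> B \in Bs ->
     forall x, x \in A :\: B ->
     exists2 y, y \in B :\: A & y |: (A :\ x) \in Bs).

Definition uniform_matroid (k : nat) : {set {set E}} :=
  [set B : {set E} | #|B| == k].

Definition circuits Bs : {set {set E}} :=
  [set D | minset (fun A => ~~ [exists B in Bs, A \subset B]) D].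

End Matroids.

Local Open Scope classical_set_scope.

(* Affine space with coordinates indexed by a finite type I is I -> K. The
   variables of {mpoly K[#|I|]} are matched with I through enum_val. *)
Section Zariski.
Variables (K : fieldType) (I : finType).
Implicit Types (X : set (I -> K)) (p : {mpoly K[#|I|]}).

Definition poly_eval p (x : I -> K) : K := p.@[fun i => x (enum_val i)].

Definition zero_locus (S : set {mpoly K[#|I|]}) : set (I -> K) :=
  [set x | forall p, S p -> poly_eval p x = 0].

Definition zariski_closed X : Prop := exists S, X = zero_locus S.

Definition zariski_open X : Prop := zariski_closed (~` X).

Definition zariski_closure X : set (I -> K) := smallest zariski_closed X.

End Zariski.

Section AlgebraicMatroid.
Variables (K : fieldType) (I : finType).
Implicit Types (X : set (I -> K)) (B : {set I}).

Definition coord_proj B (x : I -> K) : {i : I | i \in B} -> K :=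
  fun b => x (val b).

Definition dominant_proj X B : Prop :=
  zariski_closure (@coord_proj B @` X) = setT.

(* "Generic" means: over some nonempty Zariski open subset of the target. *)
Definition generically_finite_proj X B : Prop :=
  exists U : set ({i : I | i \in B} -> K),
    [/\ zariski_open U, U !=set0 &
        forall y, U y -> finite_set (X `&` @coord_proj B @^-1` [set y])].

Definition algebraic_matroid X : {set {set I}} :=
  [set B : {set I} |
    `[< generically_finite_proj X B /\ dominant_proj X B >]]%SET.

End AlgebraicMatroid.

Variant heron_index := e12 | e13 | e23 | e123.

Definition heron_index_code (e : heron_index) : 'I_4 :=
  inord (match e with e12 => 0 | e13 => 1 | e23 => 2 | e123 => 3 end).

Definition heron_index_decode (i : 'I_4) : heron_index :=
  match val i with 0 => e12 | 1 => e13 | 2 => e23 | _ => e123 end.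

Lemma heron_index_codeK : cancel heron_index_code heron_index_decode.
Proof. by case; rewrite /heron_index_decode /= inordK. Qed.

HB.instance Definition _ := Equality.copy heron_index
  (can_type heron_index_codeK).
HB.instance Definition _ := Choice.copy heron_index
  (can_type heron_index_codeK).
HB.instance Definition _ := Countable.copy heron_index
  (can_type heron_index_codeK).
HB.instance Definition _ := Finite.copy heron_index
  (can_type heron_index_codeK).

Section Heron.
Variable K : fieldType.

(* Heron's formula: x123 is the squared area of the triangle whose squared
   side lengths are x12, x13, x23. *)
Definition heron_area (x12 x13 x23 : K) : K :=
  16%:R^-1 * (2%:R * x12 * x13 + 2%:R * x12 * x23 + 2%:R * x13 * x23
              - x12 ^+ 2 - x13 ^+ 2 - x23 ^+ 2).

Definition heron_map (t : K * K * K) : heron_index -> K :=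
  let: (x12, x13, x23) := t in
  fun e => match e with
           | e12 => x12
           | e13 => x13
           | e23 => x23
           | e123 => heron_area x12 x13 x23
           end.

Definition heron_variety : set (heron_index -> K) :=
  zariski_closure (range heron_map).

End Heron.

Arguments heron_variety K : clear implicits.

(* Main.v *)
(* X_2 is the graph of Heron's formula, hence the hypersurface f = 0 with
   f = x_123 - area(x_12, x_13, x_23). On every line parallel to a coordinate
   axis f restricts to a nonconstant univariate polynomial, so over an
   algebraically closed field the projection of X_2 forgetting any single
   coordinate is surjective with finite fibres. Forgetting at least two
   coordinates makes every fibre infinite, since one of them can be chosen
   freely and another then solved for; forgetting none is not dominant, since
   f vanishes on X_2. The bases are thus exactly the 3-element sets. *)
Require Import Defs.
From mathcomp Require Import all_boot all_order all_algebra.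
From mathcomp Require Import boolp classical_sets cardinality reals.
From mathcomp Require Import complex mpoly.
From mathcomp Require Import ring.

Set Implicit Arguments.
Unset Strict Implicit.
Unset Printing Implicit Defensive.

Import Order.TTheory GRing.Theory Num.Theory.

Local Open Scope ring_scope.

(** * Bases and circuits of uniform matroids *)

Section UniformMatroid.
Variables (E : finType) (k : nat).
Hypothesis le_k_E : (k <= #|E|)%N.

Lemma ex_superset_card (A : {set E}) :
  (#|A| <= k)%N -> exists2 B : {set E}, A \subset B & #|B| = k.
Proof.
move=> leAk; have [n def_n] : {n | k - #|A| = n}%N by exists (k - #|A|)%N.
elim: n A leAk def_n => [|n IHn] A leAk def_n.
  by exists A => //; apply/eqP; rewrite eqn_leq leAk -subn_eq0 def_n.
have ltAk : (#|A| < k)%N by rewrite -subn_gt0 def_n.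
have [x xA] : exists x, x \in ~: A.
  apply/set0Pn; rewrite -card_gt0 cardsCs finset.setCK subn_gt0.
  exact: leq_trans ltAk le_k_E.
have cardxA : #|x |: A| = #|A|.+1 by rewrite cardsU1 -finset.in_setC xA.
have [||B sAB cardB] := IHn (x |: A); rewrite ?cardxA //.
  by rewrite subnS def_n.
by exists B => //; apply: fintype.subset_trans sAB; apply: finset.subsetUr.
Qed.

Lemma is_matroid_uniform : is_matroid (uniform_matroid E k).
Proof.
split=> [|A B].
  have [|B _ cardB] := @ex_superset_card finset.set0; first by rewrite cards0.
  by exists B; rewrite inE cardB.
rewrite !inE => /eqP cardA /eqP cardB x /setDP[xA xB].
have [y /setDP[yB yA]] : exists y, y \in B :\: A.
  apply/set0Pn; rewrite finset.setD_eq0; apply/negP => sBA.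
  have /eqP eqBA : B == A by rewrite eqEcard sBA cardA cardB /=.
  by rewrite eqBA xA in xB.
exists y; rewrite !inE ?yA //.
have := cardsD1 x A; rewrite xA cardA => ->.
by rewrite cardsU1 !inE (negbTE yA) andbF.
Qed.

(** A set lies in no basis exactly when it has more than [k] elements, and the minimal such sets
    have [k.+1] elements. *)
Lemma circuits_uniform :
  circuits (uniform_matroid E k) = uniform_matroid E k.+1.
Proof.
have dep (A : {set E}) :
    ~~ [exists B in uniform_matroid E k, A \subset B] = (k < #|A|)%N.
  rewrite ltnNge; congr (~~ _); apply/exists_inP/idP => [[B]|].
    by rewrite inE => /eqP <-; apply: subset_leq_card.
  by move=> /ex_superset_card[B sAB cardB]; exists B; rewrite // inE cardB.
apply/setP => D; rewrite !inE; apply/minsetP/eqP => [[] | cardD].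
  rewrite dep => ltkD minD; apply/eqP; rewrite eqn_leq ltkD andbT.
  have [x xD] : exists x, x \in D.
    by apply/set0Pn; rewrite -card_gt0 (leq_ltn_trans _ ltkD).
  (* If [D] had more than [k.+1] elements, [D :\ x] would still be dependent, against minimality. *)
  rewrite leqNgt; apply/negP => lt2; have /setP/(_ x) : D :\ x = D.
    apply: minD; last exact: finset.subD1set.
    by move: lt2; rewrite dep (cardsD1 x D) xD ltnS.
  by rewrite !inE eqxx xD.
split=> [|A]; first by rewrite dep cardD.
by rewrite dep => ltkA sAD; apply/eqP; rewrite eqEcard sAD cardD.
Qed.

End UniformMatroid.

Local Open Scope classical_set_scope.

(** * Polynomial functions, Zariski closed sets and coordinate projections *)

Section Zariski.
Variables (K : fieldType) (I : finType).
Implicit Types (f g : (I -> K) -> K).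

(** Lets polynomials be handled as functions of coordinates named by [I], hiding the enumeration of
    the variables. *)
Definition polynomial_fun f :=
  exists p : {mpoly K[#|I|]}, forall x, poly_eval p x = f x.

Lemma polynomial_fun_cst c : polynomial_fun (fun=> c).
Proof. by exists c%:MP => x; rewrite /poly_eval mevalC. Qed.

Lemma polynomial_fun_coord i : polynomial_fun (fun x => x i).
Proof.
by exists 'X_(enum_rank i) => x; rewrite /poly_eval mevalXU enum_rankK.
Qed.

Lemma polynomial_funD f g :
  polynomial_fun f -> polynomial_fun g -> polynomial_fun (fun x => f x + g x).
Proof.
move=> [p pE] [q qE]; exists (p + q) => x.
by rewrite -pE -qE /poly_eval mevalD.
Qed.

Lemma polynomial_funM f g :
  polynomial_fun f -> polynomial_fun g -> polynomial_fun (fun x => f x * g x).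
Proof.
move=> [p pE] [q qE]; exists (p * q) => x.
by rewrite -pE -qE /poly_eval mevalM.
Qed.

Lemma polynomial_funB f g :
  polynomial_fun f -> polynomial_fun g -> polynomial_fun (fun x => f x - g x).
Proof.
move=> [p pE] [q qE]; exists (p - q) => x.
by rewrite -pE -qE /poly_eval mevalB.
Qed.

Lemma zariski_closed_hypersurface f :
  polynomial_fun f -> zariski_closed [set x | f x = 0].
Proof.
move=> [p pE]; exists [set p]; apply/seteqP; split=> x /=.
  by move=> fx0 _ ->; rewrite pE.
by move=> /(_ p erefl); rewrite pE.
Qed.

Lemma zariski_openT : zariski_open [set: I -> K].
Proof.
rewrite /zariski_open setCT.
suff -> : set0 = [set x : I -> K | 1 = 0 :> K].
  exact/zariski_closed_hypersurface/polynomial_fun_cst.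
by apply/seteqP; split=> x //= /eqP; rewrite oner_eq0.
Qed.

Lemma zariski_closureT : zariski_closure [set: I -> K] = setT.
Proof. by apply/seteqP; split=> // x _; apply: sub_gen_smallest. Qed.

Definition upd (x : I -> K) j t : I -> K := fun i => if i == j then t else x i.

(** A right inverse of [coord_proj] with default value 0 outside [B]; [upd] then moves this point
    within the fibre over [y]. *)
Definition ext0 (B : {set I}) (y : {i : I | i \in B} -> K) : I -> K :=
  fun i => oapp y 0 (insub i).

Lemma coord_proj_ext0 (B : {set I}) (y : {i : I | i \in B} -> K) :
  coord_proj (ext0 y) = y.
Proof. by apply/funext => b; rewrite /coord_proj /ext0 valK. Qed.

Lemma coord_proj_upd (B : {set I}) x j t :
  j \notin B -> coord_proj (B := B) (upd x j t) = coord_proj x.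
Proof.
move=> jB; apply/funext => b; rewrite /coord_proj /upd.
by case: eqP => // bj; rewrite -bj (valP b) in jB.
Qed.

End Zariski.

Lemma polynomial_fun_reindex (K : fieldType) (I J : finType) (h : I -> J)
    (f : (I -> K) -> K) :
  polynomial_fun f -> polynomial_fun (fun y : J -> K => f (y \o h)).
Proof.
move=> [p pE].
(* Substitute the variable of [h i] for the variable of [i]. *)
exists (p \mPo [tuple 'X_(enum_rank (h (enum_val i))) | i < #|I|]) => y.
rewrite -pE /poly_eval comp_mpoly_meval; apply: meval_eq => i.
by rewrite tnth_mktuple mevalXU enum_rankK.
Qed.

Lemma finite_roots (K : closedFieldType) (p : {poly K}) :
  p != 0 -> finite_set [set t | root p t].
Proof.
move=> p0; have [r pE] := closed_field_poly_normal p.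
apply: (sub_finite_set _ (finite_seq r)) => t /=.
by rewrite pE rootZ ?lead_coef_eq0 // root_prod_XsubC.
Qed.

Lemma infinite_setT_num (K : numDomainType) : infinite_set [set: K].
Proof.
move=> finK; apply: infinite_nat.
have -> : [set: nat] = (fun n => n%:R : K) @^-1` setT by [].
by apply: finite_preimage => // m n _ _ /eqP; rewrite eqr_nat => /eqP.
Qed.

(** * Matroid of a hypersurface whose equation is nonconstant along every axis direction *)

Section QuasiFiniteHypersurface.
Variables (K : numClosedFieldType) (I : finType) (f : (I -> K) -> K).
Hypothesis f_poly : polynomial_fun f.
(** Size above 1 means positive degree, so each line parallel to an axis meets the hypersurface in a
    finite nonempty set. *)
Hypothesis f_upd : forall x j, exists2 p : {poly K},
  (1 < size p)%N & forall t, p.[t] = f (upd x j t).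

Let X : set (I -> K) := [set x | f x = 0].

Lemma hypersurface_upd x j : exists t, X (upd x j t).
Proof.
have [p p_gt1 pE] := f_upd x j.
have /closed_rootP[t /rootP] : size p != 1%N by rewrite gtn_eqF.
by rewrite pE; exists t.
Qed.

(** The fibre over [y] consists of the zeros of [f] on the line through [ext0 y] in direction [j].
    It is finite for every [y], so [setT] serves as the open set, and nonempty, so the projection is
    onto. *)
Lemma hypersurface_basis j :
  generically_finite_proj X (~: [set j])%SET /\ dominant_proj X (~: [set j])%SET.
Proof.
have jB : j \notin (~: [set j])%SET by rewrite !inE eqxx.
split.
  exists setT; split=> [||y _]; first exact: zariski_openT.
    by exists (fun=> 0).
  have [p p_gt1 pE] := f_upd (ext0 y) j.
  have p0 : p != 0 by rewrite -size_poly_gt0 ltnW.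
  apply: sub_finite_set (finite_image (upd (ext0 y) j) (finite_roots p0)).
  move=> x [Xx /= xy].
  have xE : upd (ext0 y) j (x j) = x.
    apply/funext => i; rewrite /upd; case: eqP => [-> //|/eqP ij].
    have iB : i \in (~: [set j])%SET by rewrite !inE.
    by rewrite /ext0 insubT /= -xy.
  by exists (x j); rewrite ?xE //= rootE pE xE; apply/eqP.
rewrite /dominant_proj -[RHS]zariski_closureT; congr zariski_closure.
apply/seteqP; split=> // y _; have [t Xt] := hypersurface_upd (ext0 y) j.
by exists (upd (ext0 y) j t); rewrite // coord_proj_upd ?coord_proj_ext0.
Qed.

(** Dominance would spread the equation [f = 0] from the image of [X] to its closure, the whole
    space. *)
Lemma hypersurface_not_dominant x :
  f x != 0 -> ~ dominant_proj X [set: I]%SET.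
Proof.
move=> /eqP fx domX; apply: fx.
(* The target has coordinates in a subtype; [lift] carries [f] over to it. *)
pose lift i : {i : I | i \in [set: I]%SET} := exist _ i (finset.in_setT i).
have lift_coord z : @coord_proj K I [set: I]%SET z \o lift = z by [].
have sub_f : setT `<=` [set y : {i | i \in [set: I]%SET} -> K | f (y \o lift) = 0].
  rewrite -domX; apply: smallest_sub => [|_ [z Xz <-]] /=.
    exact/zariski_closed_hypersurface/polynomial_fun_reindex.
  by rewrite lift_coord.
by have := sub_f (coord_proj x) Logic.I => /=; rewrite lift_coord.
Qed.

Lemma hypersurface_not_finite (B : {set I}) :
  (#|B|.+1 < #|I|)%N -> ~ generically_finite_proj X B.
Proof.
move=> ltBI [U [_ [y Uy] /(_ y Uy) finXy]].
have /card_gt1P[j [k [jB kB jk]]] : (1 < #|~: B|)%N.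
  by rewrite cardsCs finset.setCK ltn_subRL addn1.
rewrite !inE in jB kB.
apply: (@infinite_setT_num K).
(* Coordinate [k] takes every value [s] on the fibre: fix [s], then solve for coordinate [j]. *)
apply: sub_finite_set (finite_image (fun x => x k) finXy) => s _.
have [t Xt] := hypersurface_upd (upd (ext0 y) k s) j.
exists (upd (upd (ext0 y) k s) j t); last first.
  by rewrite /upd eq_sym (negbTE jk) eqxx.
by split=> //=; rewrite !coord_proj_upd ?coord_proj_ext0.
Qed.

Lemma algebraic_matroid_hypersurface n :
  #|I| = n.+1 -> algebraic_matroid X = uniform_matroid I n.
Proof.
move=> cardI; apply/setP => B; rewrite !inE.
apply/asboolP/eqP => [[finB domB] | cardB]; last first.
  have /cards1P[j CB] : #|~: B| == 1%N.
    by rewrite cardsCs finset.setCK cardI cardB subSnn.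
  by rewrite -(finset.setCK B) CB; apply: hypersurface_basis.
apply/eqP; rewrite eqn_leq; apply/andP; split; last first.
  by rewrite leqNgt -ltnS -cardI; apply/negP => /hypersurface_not_finite.
rewrite leqNgt; apply/negP => ltnB.
have BT : B = [set: I]%SET.
  by apply/eqP; rewrite eqEcard finset.subsetT cardsT cardI.
have /card_gt0P[j _] : (0 < #|I|)%N by rewrite cardI.
have [p p_gt1 pE] := f_upd (fun=> 0) j.
(* It remains to find a point where [f] is nonzero: otherwise every element of [K] would be a root
   of [p]. *)
apply: (@infinite_setT_num K).
have p0 : p != 0 by rewrite -size_poly_gt0 ltnW.
apply: sub_finite_set (finite_roots p0) => t _; rewrite /= rootE pE.
by apply/negPn/negP => /hypersurface_not_dominant; rewrite -BT.
Qed.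

End QuasiFiniteHypersurface.

(** * The equation of the Heron variety *)

Section HeronVariety.
Variable K : numClosedFieldType.

Definition heron_eq (x : heron_index -> K) : K :=
  x e123 - heron_area (x e12) (x e13) (x e23).

Lemma polynomial_fun_heron_eq : polynomial_fun heron_eq.
Proof.
rewrite /heron_eq /heron_area.
by do ![ apply: polynomial_funB | apply: polynomial_funD
       | apply: polynomial_funM | apply: polynomial_fun_coord
       | apply: polynomial_fun_cst ].
Qed.

(** The image of [heron_map] is a graph, already closed, so taking the closure adds no point. *)
Lemma heron_varietyE : heron_variety K = [set x | heron_eq x = 0].
Proof.
apply/seteqP; split=> [|x /= /subr0_eq x123].
  apply: smallest_sub => [|_ [[[a b] c] _ <-]].
    exact/zariski_closed_hypersurface/polynomial_fun_heron_eq.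
  by rewrite /= /heron_eq subrr.
apply: sub_gen_smallest; exists (x e12, x e13, x e23) => //.
by apply/funext; case.
Qed.

Lemma heron_area_poly (a b s : K) : exists2 p : {poly K},
  (1 < size p)%N & forall t, p.[t] = s - heron_area t a b.
Proof.
(* Sixteen times the area is [2 t (a + b) - t^2 - (a - b)^2]. The leading coefficient 1/16 is
   nonzero in characteristic 0. *)
pose r := [:: s + 16%:R^-1 * (a - b) ^+ 2; - 8%:R^-1 * (a + b); 16%:R^-1].
exists (Poly r) => [|t].
  by rewrite (@PolyK _ 0) //= invr_eq0 pnatr_eq0.
by rewrite horner_Poly /= /heron_area; field.
Qed.

Lemma heron_eq_upd x j : exists2 p : {poly K},
  (1 < size p)%N & forall t, p.[t] = heron_eq (upd x j t).
Proof.
(* Heron's formula is symmetric, so any side can be moved to the first argument, where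
   [heron_area_poly] applies. *)
have area12 a b c : heron_area b a c = heron_area a b c :> K.
  by rewrite /heron_area; congr (_ * _); ring.
have area23 a b c : heron_area b c a = heron_area a b c :> K.
  by rewrite /heron_area; congr (_ * _); ring.
case: j.
- have [p p_gt1 pE] := heron_area_poly (x e13) (x e23) (x e123).
  by exists p => // t; rewrite pE /heron_eq /upd; do !case: eqP => // _.
- have [p p_gt1 pE] := heron_area_poly (x e12) (x e23) (x e123).
  exists p => // t; rewrite pE -area12 /heron_eq /upd.
  by do !case: eqP => // _.
- have [p p_gt1 pE] := heron_area_poly (x e12) (x e13) (x e123).
  exists p => // t; rewrite pE -area23 /heron_eq /upd.
  by do !case: eqP => // _.
(* In the area coordinate the equation is monic of degree 1. *)
exists ('X - (heron_area (x e12) (x e13) (x e23))%:P).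
  by rewrite size_XsubC.
by move=> t; rewrite !hornerE /heron_eq /upd; do !case: eqP => // _.
Qed.

End HeronVariety.

(** * The four-element ground set and its matroid *)

Lemma setT_heron_index : [set: heron_index]%SET = [set e12; e13; e23; e123]%SET.
Proof. by apply/setP => e; rewrite !inE; case: e; rewrite eqxx ?orbT. Qed.

Lemma card_heron_index : #|{: heron_index}| = 4.
Proof.
rewrite -cardsT setT_heron_index -!finset.setUA !cardsU1 cards1.
by rewrite !inE; do 6?case: eqP => // _.
Qed.

Theorem theorem4p2 (R : realType) :
  let M2 : {set {set heron_index}} :=
    algebraic_matroid (heron_variety R[i]) in
  [/\ is_matroid M2,
      #|{: heron_index}| = 4,
      M2 = uniform_matroid heron_index 3
    & circuits M2 = [set [set e12; e13; e23; e123]]%SET].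
Proof.
move=> M2; have M2E : M2 = uniform_matroid heron_index 3.
  rewrite /M2 heron_varietyE.
  apply: algebraic_matroid_hypersurface card_heron_index.
    exact: polynomial_fun_heron_eq.
  exact: heron_eq_upd.
split; [| exact: card_heron_index | exact: M2E |].
  by rewrite M2E; apply: is_matroid_uniform; rewrite card_heron_index.
rewrite M2E circuits_uniform ?card_heron_index // -setT_heron_index.
(* The circuits are the 4-element subsets, and only the whole ground set has 4 elements. *)
apply/setP => D; rewrite !inE eqEcard finset.subsetT cardsT eqn_leq.
by have := max_card (mem D); rewrite card_heron_index => ->.
Qed.
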